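(* As $n\to\infty$, $K_n/\sqrt n$ converges in distribution to a random variable $R$ with \[ \mathbb{P}(R>x)=e^{-x^2},\qquad x\ge 0. \] Equivalently, the limit $R$ is Rayleigh with scale parameter $1/\sqrt 2$.
   Context: Let $n\ge 3$ and let $C_n$ be the cycle graph on vertex set $\mathbb{Z}/n\mathbb{Z}$ ($v$ is adjacent to $v-1$ and $v+1$). Let $\pi=(\pi_1,\dots,\pi_n)$ be a uniformly random permutation (ordering) of the vertices, and $A_t=\{\pi_1,\dots,\pi_t\}$ for $0\le t\le n$. A vertex $v\in A_t$ is isolated at time $t$ if neither neighbor of $v$ lies in $A_t$. Define $\tau_n=\max\{t: \text{the induced subgraph } C_n[A_t]\text{ contains an isolated vertex}\}$ and $K_n=n-\tau_n$. The Rayleigh law with scale $\sigma>0$ has tail $x\mapsto e^{-x^2/(2\sigma^2)}$ for $x\ge0$. *)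

(* Defs.v *)
From HB Require Import structures.
From mathcomp Require Import all_boot all_order all_algebra fingroup perm.
From mathcomp Require Import finmap.
From mathcomp Require Import all_classical all_reals all_analysis.
Set Implicit Arguments.
Unset Strict Implicit.
Unset Printing Implicit Defensive.
Import Order.TTheory GRing.Theory Num.Theory.
Import numFieldNormedType.Exports.
Local Open Scope classical_set_scope.
Local Open Scope ring_scope.

Section combinatorics.
Local Open Scope nat_scope.

(* [ordS] and [ord_pred] are v + 1 and v - 1 modulo n. *)
Definition cycle_adj n : rel 'I_n :=
  fun u v => (u == ordS v) || (u == ord_pred v).

Definition isolated (T : finType) (e : rel T) (A : {set T}) (v : T) : bool :=
  (v \in A) && [forall u in A, ~~ e u v].

(* The vertex [pi i] is the (i+1)-st in the ordering. *)
Definition first_vertices n (pi : 'S_n) (t : nat) : {set 'I_n} :=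
  [set pi i | i : 'I_n & i < t].

(* The maximum is over a nonempty set as soon as n >= 3 (t = 1 qualifies);
   for n = 0 or n = 1 it has the default value 0. *)
Definition tau n (pi : 'S_n) : nat :=
  \max_(t < n.+1 | [exists v, isolated (@cycle_adj n) (first_vertices pi t) v])
     t.

(* No truncation occurs, as tau pi <= n. *)
Definition K n (pi : 'S_n) : nat := n - tau pi.

End combinatorics.

HB.instance Definition _ (T : finType) :=
  isPointed.Build (perm_type T) (1%g : {perm T}).

HB.instance Definition _ (T : finType) := @isMeasurable.Build
  default_measure_display (perm_type T) discrete_measurable discrete_measurable0
  discrete_measurableC discrete_measurableU.

Section uniform_perm.
Context (R : realType) (T : finType).

Definition uniform_perm : set {perm T} -> \bar R :=
  mscale (#|{perm T}|%:R^-1)%:nng counting.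

HB.instance Definition _ := Measure.on uniform_perm.

Let uniform_perm_setT : uniform_perm [set: {perm T}] = 1%E.
Proof.
rewrite /uniform_perm /mscale/= /counting asboolT; last exact: finite_finset.
have -> : fset_set [set: {perm T}] = [fset x | x in {perm T}]%fset.
  apply/fsetP => x; rewrite in_fset_set; last exact: finite_finset.
  by rewrite in_setT in_fsetE.
rewrite card_finset -EFinM mulVf // pnatr_eq0 -lt0n.
by apply/card_gt0P; exists 1%g.
Qed.

HB.instance Definition _ :=
  Measure_isProbability.Build _ _ R uniform_perm uniform_perm_setT.

End uniform_perm.
Arguments uniform_perm R T : clear implicits.

Section scaled_K.
Context (R : realType) (n : nat).

Definition scaled_K (pi : 'S_n) : R := (K pi)%:R / Num.sqrt n%:R.

Let measurable_scaled_K : measurable_fun [set: 'S_n] scaled_K.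
Proof. by []. Qed.

HB.instance Definition _ := isMeasurableFun.Build _ _ _ _ scaled_K
  measurable_scaled_K.

Definition scaled_K_RV : {RV (uniform_perm R 'I_n) >-> R} := scaled_K.

End scaled_K.

Definition cvg_in_distribution (R : realType) (d_ : nat -> measure_display)
    (T_ : forall n, measurableType (d_ n)) (P_ : forall n, probability (T_ n) R)
    (X_ : forall n, {RV (P_ n) >-> R})
    (d : measure_display) (T : measurableType d) (P : probability T R)
    (X : {RV P >-> R}) : Prop :=
  forall x : R, {for x, continuous (cdf X)} ->
    cdf (X_ n) x @[n --> \oo] --> cdf X x.

Definition rayleigh (R : realType) (sigma : R)
    (d : measure_display) (T : measurableType d) (P : probability T R)
    (X : {RV P >-> R}) : Prop :=
  forall x : R, 0 <= x ->
    ccdf X x = (expR (- x ^+ 2 / (2 * sigma ^+ 2)))%:E.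

(* Main.v *)
From HB Require Import structures.
Require Import Defs.
From mathcomp Require Import all_boot all_order all_algebra fingroup perm.
From mathcomp Require Import zify ring lra.
Set Implicit Arguments.
Unset Strict Implicit.
Unset Printing Implicit Defensive.
Import Order.TTheory GRing.Theory Num.Theory.

(** Read the ordering backwards: the complement B of [first_vertices pi (n - j)]
    is a uniformly random set of j vertices, grown one vertex at a time, and
    [K pi > k] says that none of the first k deletions leaves an isolated vertex
    behind. Let p_j be the probability of [K pi > j] ([survival]).

    Suppose that A has no isolated vertex and that B = ~: A has j elements. A
    vertex u of A is critical if deleting it isolates a neighbour; this happens
    exactly when, in one of the two directions, the next vertex lies in A and
    the one after it in B ([criticalE]). So u is at distance 2 from B, and there
    are at most 2 j critical vertices; there are exactly 2 j of them unless B
    contains pairs of vertices at distance 1, 2 or 4, each of which spoils a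
    bounded number of them ([card_critical], [card_critical_ge]). For each fixed
    nonzero difference d, the expected number of pairs (v, v + d) in B is at
    most j^2 / (n - 1) ([sum_card_pairs]). The next vertex to be deleted is
    uniform on A ([exchangeable_count], [good_step]), whence, up to an error of
    at most 5 j^2 / ((n - 1) (n - j)) that can only increase p_(j+1),

      p_(j+1) = p_j (1 - 2 j / (n - j)).

    The product of these factors is about exp (- k^2 / n) and the errors add up
    to O(k^3 / n^2); [survival_ge] and [survival_le] are explicit forms of this.
    With k the integer part of x sqrt n, both bounds tend to exp (- x^2)
    ([cvg_survival]), and this is the tail of K_n / sqrt n at x since K_n is an
    integer ([ccdf_scaled_K]). The limit variable is the identity on the real
    line, under the Lebesgue-Stieltjes measure of 1 - exp (- (max 0 x)^2). *)

(** * Exchangeability of random orderings *)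

Section exchangeability.
Context (n : nat).
Implicit Types (pi : 'S_n) (i : 'I_n) (J : {set 'I_n}).

(** Exchanging the values of [pi] at two positions of J permutes the orderings,
    so, for a condition [Q pi] that does not see the order of the values on J,
    the value at the single position i0 behaves like the value at a uniformly
    random position of J. *)
Lemma exchangeable_count J i0 (Q : 'S_n -> pred 'I_n) :
    i0 \in J ->
    (forall i pi, i \in J -> Q (tperm i0 i * pi)%g =1 Q pi) ->
  (#|J| * #|[set pi | Q pi (pi i0)]| =
     \sum_(pi : 'S_n) #|[set i in J | Q pi (pi i)]|)%N.
Proof.
move=> i0J QJ.
under eq_bigr => pi _ do rewrite -sum1dep_card.
rewrite (exchange_big_dep (mem J)) /=; last by move=> pi i _ /andP[].
rewrite -sum_nat_const; apply: eq_bigr => i iJ; rewrite -sum1dep_card.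
rewrite (reindex_inj (mulgI (tperm i0 i))) /=.
by apply: eq_bigl => pi; rewrite iJ QJ // permM tpermL.
Qed.

(** Given [pi i], the value [pi i'] is uniform on the n - 1 remaining ones. *)
Lemma card_perm_mapsto_le i i' (f : 'I_n -> 'I_n) :
  i != i' -> (n.-1 * #|[set pi : 'S_n | pi i' == f (pi i)]| <= n`!)%N.
Proof.
move=> ii'; have Jn : #|[set~ i]| = n.-1 by rewrite cardsC1 card_ord.
rewrite -{1}Jn.
rewrite (@exchangeable_count [set~ i] i' (fun pi v => v == f (pi i))).
- have <- : (\sum_(pi : 'S_n) 1 = n`!)%N.
    by rewrite sum1_card card_Sn.
  apply: leq_sum => pi _.
  have /subset_leq_card : [set j in [set~ i] | pi j == f (pi i)]
      \subset [set pi^-1%g (f (pi i))].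
    by apply/subsetP => j; rewrite !inE => /andP[_ /eqP <-]; rewrite permK.
  by rewrite cards1.
- by rewrite !inE eq_sym.
- move=> j pi; rewrite !inE => ji v; congr (_ == f _).
  by rewrite permM tpermD // eq_sym // eq_sym.
Qed.

(** The first moment bound on pairs (v, f v) in the random set [pi @: J]: there
    are #|J| ^ 2 pairs of positions, and each realizes such a pair with
    probability at most 1 / (n - 1). *)
Lemma sum_card_pairs (J : {set 'I_n}) (f : 'I_n -> 'I_n) :
    (forall v, f v != v) ->
  (n.-1 * \sum_(pi : 'S_n) #|[set v in pi @: J | f v \in pi @: J]|
     <= #|J| ^ 2 * n`!)%N.
Proof.
move=> f_neq.
have -> : (\sum_(pi : 'S_n) #|[set v in pi @: J | f v \in pi @: J]| =
    \sum_(i in J) \sum_(i' in J) #|[set pi : 'S_n | pi i' == f (pi i)]|)%N.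
  transitivity (\sum_(pi : 'S_n) \sum_(i in J) \sum_(i' in J)
      (pi i' == f (pi i)))%N.
    apply: eq_bigr => pi _; rewrite -sum1dep_card big_mkcondr /=.
    rewrite big_imset /=; last by move=> ? ? _ _; apply: perm_inj.
    apply: eq_bigr => i iJ; case: ifPn.
      case/imsetP=> j jJ fj; rewrite (bigD1 j) //= fj eqxx big1 // => i'.
      by case/andP=> _ /negPf; rewrite (inj_eq perm_inj) => ->.
    move=> fJ; rewrite big1 // => i' i'J; case: eqP => // e.
    by case/negP: fJ; rewrite -e imset_f.
  rewrite exchange_big; apply: eq_bigr => i _.
  rewrite exchange_big; apply: eq_bigr => i' _.
  by rewrite -sum1dep_card [RHS]big_mkcond.
rewrite big_distrr -mulnn -mulnA -sum_nat_const /=; apply: leq_sum => i _.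
rewrite big_distrr -sum_nat_const /=; apply: leq_sum => i' _.
have [<-|ii'] := eqVneq i i'; last exact: card_perm_mapsto_le.
rewrite (_ : [set _ | _] = set0) ?cards0 ?muln0 //.
by apply/setP => pi; rewrite !inE eq_sym (negPf (f_neq _)).
Qed.

End exchangeability.

(** * Critical vertices on the cycle *)

Section cycle.
(* On n >= 5 vertices the differences 1, 2 and 4 are nonzero modulo n. *)
Context (m : nat).
Notation V := 'I_m.+4.+1.
Implicit Types (A : {set V}) (u v s : V).
Local Open Scope ring_scope.

Lemma ordSE v : ordS v = v + 1.
Proof. by apply: val_inj; rewrite /= addn1. Qed.

Lemma ord_predE v : ord_pred v = v - 1.
Proof. by apply: (canLR (@ordSK _)); rewrite ordSE subrK. Qed.

Lemma natr_V_neq0 k : (0 < k < 5)%N -> k%:R != 0 :> V.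
Proof.
move=> /andP[k0 k5]; apply/negP => /eqP/(congr1 val) /=.
by rewrite (Zp_nat m.+3) /= modn_small; lia.
Qed.

Lemma addr_nat_neq u k : (0 < k < 5)%N -> u + k%:R != u.
Proof.
move/natr_V_neq0; apply: contraNneq => /(canRL (addKr _)) ->.
by rewrite addNr.
Qed.

Lemma isolatedE A v :
  isolated (@cycle_adj _) A v = [&& v \in A, v + 1 \notin A & v - 1 \notin A].
Proof.
rewrite /isolated; congr (_ && _); apply/forall_inP/andP.
  move=> H; split; apply/negP => /H; rewrite /cycle_adj ordSE ord_predE eqxx //.
  by rewrite orbT.
move=> [nS nP] u uA; rewrite /cycle_adj ordSE ord_predE; apply/norP.
split; first by apply: contraNneq nS => <-.
by apply: contraNneq nP => <-.
Qed.

Definition has_isolated A := [exists v, isolated (@cycle_adj _) A v].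

Definition critical A : {set V} := [set u in A | has_isolated (A :\ u)].

Definition side_critical A s : {set V} :=
  [set u in A | (u + s \in A) && (u + s + s \notin A)].

Arguments side_critical A%_set_scope s%_R.

(** Deleting u can only isolate a neighbour v of u, and it does so iff the other
    neighbour of v is already missing. *)
Lemma criticalE A : ~~ has_isolated A ->
  critical A = side_critical A 1 :|: side_critical A (-1).
Proof.
move=> nA; apply/setP => u; rewrite !inE -andb_orr.
have [uA|//] := boolP (u \in A) => /=.
have two (w : V) : w + 1 != w - 1.
  rewrite eq_sym subr_eq -addrA -mulr2n eq_sym.
  exact: (@addr_nat_neq w 2 isT).
apply/existsP/orP => [[v]|[]/andP[u1 u2]].
- have := nA; rewrite negb_exists => /forallP/(_ v).
  rewrite !isolatedE !inE !negb_and !negbK.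
  move=> nv /and3P[/andP[vu vA] /orP[/eqP e|v1] /orP v2].
    right; rewrite -e !addrK vA /=.
    by case: v2 => // /eqP; rewrite -e => /esym/eqP; rewrite (negPf (two _)).
  left; move: nv; rewrite vA (negPf v1) /= => v3.
  by case: v2 => [/eqP <-|]; rewrite ?v3 // !subrK vA v1.
- exists (u + 1); rewrite isolatedE !inE u1 addrK eqxx (negPf u2) andbF !andbT.
  exact: (@addr_nat_neq u 1 isT).
- exists (u - 1); rewrite isolatedE !inE u1 subrK eqxx (negPf u2) andbF !andbT.
  by rewrite subr_eq eq_sym; exact: (@addr_nat_neq u 1 isT).
Qed.

Lemma card_side_critical A s : (#|side_critical A s| <= #|~: A|)%N.
Proof.
rewrite -(card_imset (side_critical A s) (addIr (s + s))).
apply/subset_leq_card/subsetP => _ /imsetP[u + ->].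
by rewrite !inE addrA => /and3P[].
Qed.

Definition close_pairs (B : {set V}) (d : V) : {set V} :=
  [set v in B | v + d \in B].

Arguments close_pairs B%_set_scope d%_R.

(** An element v of the complement comes from the critical vertex v - 2 s unless
    v - s or v - 2 s is itself in the complement. *)
Lemma card_side_critical_ge A s :
  (#|~: A| <= #|side_critical A s| + #|close_pairs (~: A) (- s)|
             + #|close_pairs (~: A) (- s - s)|)%N.
Proof.
have -> : #|side_critical A s| = #|+%R^~ (s + s) @: side_critical A s|.
  by rewrite card_imset //; exact: addIr.
apply: leq_trans (leq_add (leq_card_setU _ _) (leqnn _)).
apply: leq_trans (leq_card_setU _ _).
apply/subset_leq_card/subsetP => v; rewrite !inE => vA.
rewrite vA /=; have [//|/= v2] := boolP (v - s \notin A); rewrite ?orbT //.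
rewrite orbF orbC; have [//|/= v3] := boolP (v + (- s - s) \notin A).
apply/imsetP; exists (v - (s + s)); last by rewrite subrK.
rewrite !inE opprD; move: v2 v3; rewrite !negbK => v2 ->.
by rewrite addrA !subrK v2.
Qed.

Lemma card_critical A : ~~ has_isolated A ->
  (#|critical A| <= 2 * #|~: A|)%N.
Proof.
move=> nA; rewrite criticalE // mul2n -addnn.
apply: leq_trans (leq_card_setU _ _) (leq_add _ _);
  exact: card_side_critical.
Qed.

(** A vertex u that is critical in both directions is counted once instead of
    twice; then u - 2 and u + 2 lie in the complement, at distance 4. *)
Lemma card_critical_ge A : ~~ has_isolated A ->
  (2 * #|~: A| <= #|critical A| +
    \sum_(d <- [:: 1; -1; 2%:R; - 2%:R; 4%:R : V]%R) #|close_pairs (~: A) d|)%N.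
Proof.
move=> nA; rewrite criticalE //.
have h1 : (#|~: A| <= #|side_critical A 1| + #|close_pairs (~: A) (-1)|
    + #|close_pairs (~: A) (- 2%:R)|)%N.
  by have := card_side_critical_ge A 1%R; rewrite -opprD.
have h2 : (#|~: A| <= #|side_critical A (-1)| + #|close_pairs (~: A) 1|
    + #|close_pairs (~: A) 2%:R|)%N.
  by have := card_side_critical_ge A (-1)%R; rewrite !opprK.
have h3 := cardsUI (side_critical A 1) (side_critical A (-1)).
have h4 : (#|side_critical A 1 :&: side_critical A (-1)| <=
  #|close_pairs (~: A) 4%:R|)%N.
  rewrite -(card_imset (_ :&: _) (addIr (- 2%:R))).
  apply/subset_leq_card/subsetP => _ /imsetP[u + ->].
  rewrite !inE => /andP[/and3P[_ _ u2] /and3P[_ _ u2']].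
  by rewrite -[4%:R]/((2 + 2)%N%:R) mulrnDr mulr2n opprD !addrA !subrK u2' u2.
rewrite !big_cons big_nil.
move: h1 h2 h3 h4; move: #|close_pairs _ 1| #|close_pairs _ (-1)|.
move: #|close_pairs _ 2%:R| #|close_pairs _ (- 2%:R)| #|close_pairs _ 4%:R|.
lia.
Qed.

End cycle.

(** * The event K > k and its one-step recurrence *)

Section first_vertices.
Context (n : nat).
Implicit Types (pi : 'S_n) (t : nat).

Lemma mem_first_vertices pi t i : (pi i \in first_vertices pi t) = (i < t)%N.
Proof.
by rewrite (mem_imset _ _ perm_inj) inE.
Qed.

Lemma first_verticesD1 pi (i : 'I_n) :
  first_vertices pi i = first_vertices pi i.+1 :\ pi i.
Proof.
apply/setP => v; rewrite -(permKV pi v); move: (_ v) => j.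
by rewrite !inE !mem_first_vertices (inj_eq perm_inj) ltnS ltn_neqAle.
Qed.

Lemma first_vertices_tperm pi t (i j : 'I_n) : (i < t)%N -> (j < t)%N ->
  first_vertices (tperm i j * pi)%g t = first_vertices pi t.
Proof.
move=> it jt; apply/setP => v; rewrite -(permKV (tperm i j * pi) v).
move: (_ v) => k; rewrite mem_first_vertices permM mem_first_vertices.
by case: tpermP => // ->; rewrite it jt.
Qed.

Lemma setC_first_vertices pi t :
  ~: first_vertices pi t = pi @: [set i : 'I_n | (t <= i)%N].
Proof.
apply/setP => v; rewrite -(permKV pi v); move: (_ v) => j.
by rewrite inE mem_first_vertices (mem_imset _ _ perm_inj) inE (leqNgt t).
Qed.

Lemma card_last_positions t : #|[set i : 'I_n | (t <= i)%N]| = (n - t)%N.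
Proof.
rewrite -sum1dep_card -(big_geq_mkord t n predT (fun=> 1%N)).
by rewrite sum_nat_const_nat muln1.
Qed.

Lemma card_setC_first_vertices pi t : #|~: first_vertices pi t| = (n - t)%N.
Proof.
rewrite setC_first_vertices card_imset ?card_last_positions //.
exact: perm_inj.
Qed.

Lemma card_first_positions t : (t <= n)%N -> #|[set i : 'I_n | (i < t)%N]| = t.
Proof.
move=> tn; rewrite -sum1dep_card -(big_ord_widen n (fun=> 1%N)) //.
by rewrite sum1_card card_ord.
Qed.

End first_vertices.

Section good_orderings.
Context (m : nat).
Notation n := m.+4.+1.
Implicit Types (pi : 'S_n) (t : nat).

(** The orderings for which the vertex sets of size at least t have no isolated
    vertex; see [K_gtE]. *)
Definition good t : {set 'S_n} :=
  [set pi | [forall s : 'I_n.+1,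
     (t <= s)%N ==> ~~ has_isolated (first_vertices pi s)]].

Lemma goodP t pi :
  reflect (forall s, (t <= s <= n)%N -> ~~ has_isolated (first_vertices pi s))
    (pi \in good t).
Proof.
rewrite inE; apply: (iffP forall_inP) => [H s /andP[ts sn]|H s ts].
  exact: (H (Ordinal (sn : (s < n.+1)%N))).
by apply: H; rewrite ts -ltnS /=.
Qed.

Lemma good0 : good 0 = set0.
Proof.
apply/setP => pi; rewrite [RHS]inE; apply/negP => /goodP/(_ 1%N isT).
rewrite negb_exists => /forallP/(_ (pi ord0)).
have memE v : (v \in first_vertices pi 1) = (v == pi ord0).
  rewrite -(permKV pi v); move: (pi^-1%g v) => i.
  by rewrite mem_first_vertices (inj_eq perm_inj) ltnS leqn0.
rewrite isolatedE !memE eqxx (@addr_nat_neq _ _ 1 isT) subr_eq eq_sym.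
by rewrite (@addr_nat_neq _ _ 1 isT).
Qed.

Lemma K_gtE pi k : (k < K pi)%N = (pi \in good (n - k)).
Proof.
have [nk|kn] := leqP n k.
  have /eqP -> : (n - k)%N == 0%N by rewrite subn_eq0.
  by rewrite good0 inE ltnNge (leq_trans (leq_subr _ _) nk).
rewrite /K ltn_subRL addnC -ltn_subRL -[(_ - k)%N]prednK ?subn_gt0 // ltnS.
apply/bigmax_leqP/goodP => H s.
  move=> /andP[ts sn]; apply/negP => I.
  by have := H (Ordinal (sn : (s < n.+1)%N)) I; rewrite /= leqNgt ts.
move=> I; rewrite leqNgt; apply/negP => ts.
by move: I; apply/negP/H; rewrite ts -ltnS ltn_ord.
Qed.

Lemma good_full : good n = setT.
Proof.
apply/setP => pi; rewrite [RHS]inE; apply/goodP => s.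
rewrite -eqn_leq => /eqP <-.
rewrite negb_exists; apply/forallP => v; rewrite isolatedE.
by rewrite -(permKV pi (v + 1)%R) mem_first_vertices ltn_ord andbF.
Qed.

(** An ordering good from t + 1 on fails at t iff the vertex in position t is
    critical; by exchangeability this has conditional probability equal to the
    proportion of critical vertices among the t + 1 that remain. *)
Lemma good_step t : (t < n)%N ->
  (t.+1 * #|good t|
     + \sum_(pi in good t.+1) #|critical (first_vertices pi t.+1)|
   = t.+1 * #|good t.+1|)%N.
Proof.
move=> tn; pose i0 : 'I_n := Ordinal tn.
pose Q pi v := (pi \in good t.+1) && (v \in critical (first_vertices pi t.+1)).
have i0J : i0 \in [set i : 'I_n | (i < t.+1)%N] by rewrite inE /= ltnSn.
have goodE pi : (pi \in good t) =
    (pi \in good t.+1) && ~~ has_isolated (first_vertices pi t).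
  apply/goodP/andP => [H|[/goodP H nI] s].
    split; last by apply: H; rewrite leqnn ltnW.
    by apply/goodP => s /andP[ts sn]; apply: H; rewrite (ltnW ts).
  by rewrite leq_eqVlt => /andP[/orP[/eqP <- //|ts] sn]; apply: H; rewrite ts.
have QJ i pi : i \in [set i : 'I_n | (i < t.+1)%N] ->
    Q (tperm i0 i * pi)%g =1 Q pi.
  rewrite inE => it v; rewrite /Q first_vertices_tperm //; congr (_ && _).
  by apply/goodP/goodP => H s /[dup] /andP[ts _] /H;
    rewrite first_vertices_tperm // (leq_trans _ ts).
have := exchangeable_count i0J QJ; rewrite card_first_positions //.
rewrite [RHS in _ = RHS -> _](bigID (mem (good t.+1))) /= addnC.
rewrite big1 ?add0n; last first.
  by move=> pi npi; apply/eqP; rewrite cards_eq0 -subset0; apply/subsetP => i;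
    rewrite !inE /Q (negPf npi) andbF.
have -> : (\sum_(pi in good t.+1)
     #|[set i in [set i : 'I_n | (i < t.+1)%N] | Q pi (pi i)]|
   = \sum_(pi in good t.+1) #|critical (first_vertices pi t.+1)|)%N.
  apply: eq_bigr => pi pig; rewrite -[LHS](card_imset _ (@perm_inj _ pi)).
  apply: eq_card => v; rewrite -(permKV pi v); move: (pi^-1%g v) => i.
  rewrite (mem_imset _ _ perm_inj) !inE /Q pig !inE mem_first_vertices /=.
  by case: (i < _)%N.
have -> : [set pi | Q pi (pi i0)] = good t.+1 :\: good t.
  apply/setP => pi.
  rewrite [LHS]in_set in_setD goodE /Q [_ \in critical _]in_set.
  rewrite mem_first_vertices ltnSn -(first_verticesD1 pi i0).
  by case: (pi \in good t.+1); case: has_isolated.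
have gS : good t \subset good t.+1.
  by apply/subsetP => pi; rewrite goodE => /andP[].
by move=> <-; rewrite -mulnDr cardsD (setIidPr gS) subnKC // subset_leq_card.
Qed.

Lemma sum_critical_le t : (t < n)%N ->
  (\sum_(pi in good t.+1) #|critical (first_vertices pi t.+1)|
   <= 2 * (n - t.+1) * #|good t.+1|)%N.
Proof.
move=> tn; rewrite mulnC -sum_nat_const; apply: leq_sum => pi /goodP H.
by rewrite -(card_setC_first_vertices pi) card_critical // H // leqnn.
Qed.

(** The loss is the expected number of close pairs, for each of the five
    differences of [card_critical_ge]. *)
Lemma sum_critical_ge t : (t < n)%N ->
  (n.-1 * (2 * (n - t.+1) * #|good t.+1|) <=
   n.-1 * (\sum_(pi in good t.+1) #|critical (first_vertices pi t.+1)|)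
   + 5 * ((n - t.+1) ^ 2 * n`!))%N.
Proof.
move=> tn; pose J := [set i : 'I_n | (t.+1 <= i)%N].
pose D := [:: 1; -1; 2%:R; - 2%:R; 4%:R : 'I_n]%R.
have le1 : (2 * (n - t.+1) * #|good t.+1| <=
   \sum_(pi in good t.+1) #|critical (first_vertices pi t.+1)| +
   \sum_(d <- D) \sum_(pi : 'S_n) #|close_pairs (pi @: J) d|)%N.
  rewrite exchange_big /= mulnC -sum_nat_const.
  apply: (@leq_trans (\sum_(pi in good t.+1)
    (#|critical (first_vertices pi t.+1)| +
     \sum_(d <- D) #|close_pairs (pi @: J) d|))%N).
    apply: leq_sum => pi /goodP H.
    rewrite -(card_setC_first_vertices pi) -setC_first_vertices.
    by rewrite card_critical_ge // H // leqnn.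
  by rewrite big_split leq_add2l big_mkcond leq_sum // => pi _; case: ifP.
apply: leq_trans (leq_mul (leqnn n.-1) le1) _; rewrite mulnDr leq_add2l.
have le2 d : d \in D ->
    (n.-1 * \sum_(pi : 'S_n) #|close_pairs (pi @: J) d|
       <= (n - t.+1) ^ 2 * n`!)%N.
  move=> dD; rewrite -card_last_positions; apply: sum_card_pairs => v.
  apply: contraTneq dD => /(canRL (addKr _)); rewrite addNr => ->.
  rewrite !inE !(eq_sym 0%R) !oppr_eq0.
  by rewrite -[1%R]/(1%:R)%R !(negPf (natr_V_neq0 _ _)).
rewrite big_distrr /= (_ : 5 = size D) // -(count_predT D).
rewrite -sum1_count big_distrl /= big_seq [X in (_ <= X)%N]big_seq.
by apply: leq_sum => d dD; rewrite mul1n le2.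
Qed.

End good_orderings.

From mathcomp Require Import finmap.
From mathcomp Require Import all_classical all_reals all_analysis.
Import Order.TTheory GRing.Theory Num.Theory.
Import numFieldNormedType.Exports.
Local Open Scope classical_set_scope.
Local Open Scope ring_scope.

(** * Solving the recurrence *)

Section recurrence.
Context {R : realType}.

(** This form of the lower bound for 1 - y suits the recurrence: for
    y = 2 j / (n - j) the exponent is the simple fraction 2 j / (n - 3 j). *)
Lemma expR_le_1B (y : R) : y < 1 -> expR (- (y / (1 - y))) <= 1 - y.
Proof.
move=> y1; have y0 : 0 < 1 - y by rewrite subr_gt0.
rewrite expRN -[leRHS]invrK lef_pV2 ?posrE ?expR_gt0 ?invr_gt0 //.
apply: le_trans (expR_ge1Dx _); rewrite le_eqVlt; apply/orP; left; apply/eqP.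
by field; rewrite gt_eqF.
Qed.

(* The sequence p abstracts the probabilities of survival: the inequalities are
   those satisfied by [survival] below. *)
Variables (n : nat) (p : nat -> R).
Hypothesis p0 : p 0 = 1.
Hypothesis p_ge0 : forall j, 0 <= p j.
Hypothesis p_lower : forall j, (j < n)%N ->
  (n - j)%:R * p j - 2 * j%:R * p j <= (n - j)%:R * p j.+1.
Hypothesis p_upper : forall j, (j < n)%N ->
  (n - j)%:R * p j.+1 <= (n - j)%:R * p j - 2 * j%:R * p j
     + 5 * j%:R ^+ 2 / (n%:R - 1).

(** The exponents 2 j / (n - 3 j) are at most 2 j / (n - 3 k), and these sum to
    (k^2 - k) / (n - 3 k). *)
Lemma survival_ge k : (3 * k < n)%N ->
  expR (- (k%:R ^+ 2 / (n%:R - 3 * k%:R))) <= p k.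
Proof.
move=> kn; have kn' : 3 * k%:R < n%:R :> R by rewrite -natrM ltr_nat.
pose a j : R := (j%:R ^+ 2 - j%:R) / (n%:R - 3 * k%:R).
suff H j : (j <= k)%N -> expR (- a j) <= p j.
  apply: le_trans (H k (leqnn k)); rewrite ler_expR lerN2 ler_wpM2r ?gerBl //.
  by rewrite invr_ge0 subr_ge0 ltW.
elim: j => [|j IH] jk.
  by rewrite /a expr0n subrr mul0r oppr0 expR0 p0.
have jk' : j%:R + 1 <= k%:R :> R by rewrite natr1 ler_nat.
have j0 : 0 <= j%:R :> R by [].
have jn : (j < n)%N by lia.
have nj : (n - j)%:R = n%:R - j%:R :> R by rewrite natrB // ltnW.
have d0 : 0 < n%:R - j%:R :> R by lra.
pose y : R := 2 * j%:R / (n%:R - j%:R).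
have y1 : y < 1 by rewrite /y ltr_pdivrMr // mul1r; lra.
have := p_lower jn; rewrite nj -mulrBl -ler_pdivrMl //.
apply: le_trans.
rewrite [leRHS](_ : _ = (1 - y) * p j); last by rewrite /y; field; lra.
apply: (@le_trans _ _ (expR (- (y / (1 - y))) * expR (- a j))); last first.
  by apply: ler_pM; rewrite ?expR_ge0 ?IH ?expR_le_1B // ltnW.
rewrite -expRD ler_expR -opprD lerN2.
have -> : y / (1 - y) = 2 * j%:R / (n%:R - 3 * j%:R).
  by rewrite /y; field; apply/andP; split; lra.
rewrite [leRHS](_ : _ = 2 * j%:R / (n%:R - 3 * k%:R) + a j).
  rewrite lerD2r ler_wpM2l ?mulr_ge0 // lef_pV2 ?posrE; lra.
by rewrite /a -natr1; field; lra.
Qed.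

(** Here 1 - 2 j / (n - j) <= exp (- 2 j / n), and the k error terms are each at
    most 5 k^2 / ((n - 1) (n - k)), with no amplification as the factors are at
    most 1. *)
Lemma survival_le k : (3 * k < n)%N -> (1 < n)%N ->
  p k <= expR (- ((k%:R ^+ 2 - k%:R) / n%:R))
     + 5 * k%:R ^+ 3 / ((n%:R - 1) * (n%:R - k%:R)).
Proof.
move=> kn n1; have kn' : 3 * k%:R < n%:R :> R by rewrite -natrM ltr_nat.
have n1' : 1 < n%:R :> R by rewrite ltr1n.
pose d : R := 5 * k%:R ^+ 2 / ((n%:R - 1) * (n%:R - k%:R)).
have k0 : 0 <= k%:R :> R by [].
have d0 : 0 <= d by rewrite /d divr_ge0 ?mulr_ge0 ?exprn_ge0 //; lra.
pose a j : R := (j%:R ^+ 2 - j%:R) / n%:R.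
suff H j : (j <= k)%N -> p j <= expR (- a j) + j%:R * d.
  apply: le_trans (H k (leqnn k)) _; rewrite lerD2l /d le_eqVlt.
  by apply/orP; left; apply/eqP; field; apply/andP; split; lra.
elim: j => [|j IH] jk.
  by rewrite /a expr0n subrr mul0r oppr0 expR0 p0 mul0r addr0.
have jk' : j%:R + 1 <= k%:R :> R by rewrite natr1 ler_nat.
have j0 : 0 <= j%:R :> R by [].
have jn : (j < n)%N by lia.
have nj : (n - j)%:R = n%:R - j%:R :> R by rewrite natrB // ltnW.
have e0 : 0 < n%:R - j%:R :> R by lra.
pose y : R := 2 * j%:R / n%:R.
have y0 : 0 <= y by rewrite /y divr_ge0 //; lra.
have y1 : y <= 1 by rewrite /y ler_pdivrMr //; lra.
have step : p j.+1 <= (1 - y) * p j + d.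
  have := p_upper jn; rewrite nj -mulrBl -ler_pdivlMl // => /le_trans; apply.
  rewrite mulrDr lerD //.
    rewrite mulrA [X in X * _ <= _]mulrC ler_wpM2r // ler_pdivrMr // /y.
    rewrite -subr_ge0 (_ : _ - _ = 2 * j%:R ^+ 2 / n%:R).
      by rewrite divr_ge0 ?mulr_ge0 ?exprn_ge0 //; lra.
    by field; lra.
  rewrite [leLHS](_ : _ = 5 * j%:R ^+ 2 * ((n%:R - 1) * (n%:R - j%:R))^-1).
    apply: ler_pM.
    - by rewrite mulr_ge0 ?exprn_ge0.
    - by rewrite invr_ge0 mulr_ge0 //; lra.
    - by rewrite ler_wpM2l // ler_pXn2r ?nnegrE //; lra.
    - by rewrite lef_pV2 ?posrE ?mulr_gt0 ?ler_wpM2l //; lra.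
  by field; apply/andP; split; lra.
apply: le_trans step _.
have /le_trans : (1 - y) * p j + d <=
    (1 - y) * (expR (- a j) + j%:R * d) + d.
  by rewrite lerD2r ler_wpM2l ?subr_ge0 // IH // ltnW.
apply; rewrite mulrDr -addrA lerD //.
  apply: (@le_trans _ _ (expR (- y) * expR (- a j))).
    by rewrite ler_wpM2r ?expR_ge0 // expR_ge1Dx.
  rewrite -expRD -opprD ler_expR lerN2 le_eqVlt; apply/orP; left; apply/eqP.
  by rewrite /a -natr1 /y; field; lra.
have jd0 : 0 <= y * (j%:R * d) by rewrite mulr_ge0 // mulr_ge0.
by rewrite -natr1; lra.
Qed.

End recurrence.

(** * The limit of the survival probabilities *)

Section survival_probability.
Context (R : realType) (m : nat).
Notation n := m.+4.+1.

(** The probability of [K pi > k] under the uniform law, by [K_gtE]. *)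
Definition survival (k : nat) : R := #|good m (n - k)|%:R / n`!%:R.

Lemma survival0 : survival 0 = 1.
Proof.
by rewrite /survival subn0 good_full cardsT card_Sn divff.
Qed.

Lemma survival_ge0 k : 0 <= survival k.
Proof. by rewrite /survival divr_ge0. Qed.

Let factR_gt0 : 0 < n`!%:R :> R. Proof. by rewrite ltr0n fact_gt0. Qed.

Lemma survival_step_ge j : (j < n)%N ->
  (n - j)%:R * survival j - 2 * j%:R * survival j <= (n - j)%:R * survival j.+1.
Proof.
move=> jn; have tn : (n - j.+1 < n)%N by lia.
have tE : (n - j.+1).+1 = (n - j)%N by lia.
have := good_step tn; have := sum_critical_le tn; rewrite tE (subKn (ltnW jn)).
rewrite /survival; move: #|_| #|_| (\sum_(_ in _) _)%N => a b S le e.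
rewrite !mulrA -mulrBl ler_pM2r ?invr_gt0 // lerBlDr -!natrM -natrD ler_nat.
lia.
Qed.

Lemma survival_step_le j : (j < n)%N ->
  (n - j)%:R * survival j.+1 <=
  (n - j)%:R * survival j - 2 * j%:R * survival j + 5 * j%:R ^+ 2 / (n%:R - 1).
Proof.
move=> jn; have tn : (n - j.+1 < n)%N by lia.
have tE : (n - j.+1).+1 = (n - j)%N by lia.
have := good_step tn; have := sum_critical_ge tn; rewrite tE (subKn (ltnW jn)).
rewrite /survival; move: #|good m (n - j)| #|good m (n - j.+1)| => a b.
move: (\sum_(_ in _) _)%N n`! factR_gt0 => S F F0.
rewrite -(ler_nat R) !(natrD, natrM, natrX) => le.
move=> /(congr1 (fun i => i%:R : R)); rewrite !(natrD, natrM) => e.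
have n1 : 0 < n%:R - 1 :> R by rewrite subr_gt0 ltr1n.
have n1E : n.-1%:R = n%:R - 1 :> R by rewrite -[in RHS](natr1 m.+4) addrK.
have {}le : 2 * j%:R * a%:R - S%:R <= 5 * (j%:R ^+ 2 * F%:R) / (n%:R - 1) :> R.
  by rewrite ler_pdivlMr // [leLHS]mulrC mulrBr lerBlDl -n1E.
rewrite -(ler_pM2r F0) mulrDl mulrBl !mulrA !divfK ?gt_eqF //.
by rewrite (mulrAC _ _^-1); lra.
Qed.

End survival_probability.

Section limit.
Context (R : realType).

Lemma cvg_sqrt_inv : (Num.sqrt m.+4.+1%:R)^-1 @[m --> \oo] --> (0 : R).
Proof.
under eq_fun do rewrite -sqrtrV //.
rewrite -(@sqrtr0 R); apply: continuous_cvg; first exact: sqrt_continuous.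
have := @cvg_harmonic R; rewrite -(cvg_shiftn 4).
by under eq_fun do rewrite /harmonic /= addn4.
Qed.

Lemma cvg_truncn_scaled (x : R) : 0 <= x ->
  (Num.truncn (x * Num.sqrt m.+4.+1%:R))%:R / Num.sqrt m.+4.+1%:R
    @[m --> \oo] --> x.
Proof.
move=> x0; apply: (@squeeze_cvgr _ _ _ _
  (fun m => x - (Num.sqrt m.+4.+1%:R)^-1) (fun=> x)).
- near=> m; set s := Num.sqrt _.
  have s0 : 0 < s by rewrite sqrtr_gt0.
  have /truncn_itv/andP[l u] : 0 <= x * s by rewrite mulr_ge0 // ltW.
  rewrite ler_pdivlMr // ler_pdivrMr // l andbT mulrBl mulVf ?gt_eqF //.
  by rewrite lerBlDr natr1 ltW.
- rewrite -[X in _ --> X]subr0.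
  by apply: cvgB; [exact: cvg_cst|exact: cvg_sqrt_inv].
- exact: cvg_cst.
Unshelve. all: by end_near. Qed.

Lemma cvg_survival (x : R) : 0 <= x ->
  survival R m (Num.truncn (x * Num.sqrt m.+4.+1%:R)) @[m --> \oo]
    --> expR (- x ^+ 2).
Proof.
move=> x0.
(* Both bounds are continuous functions of u = k / sqrt n and w = 1 / sqrt n,
   which tend to x and 0. *)
pose w m : R := (Num.sqrt m.+4.+1%:R)^-1.
pose k m := Num.truncn (x * Num.sqrt m.+4.+1%:R : R).
pose u m : R := (k m)%:R * w m.
have w0 : w m @[m --> \oo] --> (0 : R) by exact: cvg_sqrt_inv.
have ux : u m @[m --> \oo] --> x by exact: cvg_truncn_scaled.
have uw0 : u m * w m @[m --> \oo] --> (0 : R).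
  by rewrite -(mulr0 x); exact: cvgM.
have uw3 : 1 - 3 * (u m * w m) @[m --> \oo] --> (1 : R).
  rewrite -[X in _ --> X]subr0 -{1}(mulr0 3); apply: cvgB; first exact: cvg_cst.
  by apply: cvgM => //; exact: cvg_cst.
have uw1 : 1 - u m * w m @[m --> \oo] --> (1 : R).
  by rewrite -[X in _ --> X]subr0; apply: cvgB => //; exact: cvg_cst.
have w1 : 1 - w m * w m @[m --> \oo] --> (1 : R).
  rewrite -[X in _ --> X]subr0 -{1}(mulr0 0); apply: cvgB; first exact: cvg_cst.
  exact: cvgM.
have u2 : u m ^+ 2 @[m --> \oo] --> x ^+ 2.
  exact: (cvg_comp _ _ ux (@exprn_continuous R 2 x)).
apply: (@squeeze_cvgr _ _ _ _
  (fun m => expR (- (u m ^+ 2 / (1 - 3 * (u m * w m)))))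
  (fun m => expR (- (u m ^+ 2 - u m * w m))
    + 5 * (u m ^+ 3 * w m) / ((1 - w m * w m) * (1 - u m * w m)))).
- near=> m.
  have s0 : 0 < w m by rewrite invr_gt0 sqrtr_gt0.
  have kE : (k m)%:R = u m / w m by rewrite mulfK ?gt_eqF.
  have nE : m.+4.+1%:R = (w m ^+ 2)^-1.
    by rewrite /w exprVn invrK sqr_sqrtr.
  have lt3 : 0 < 1 - 3 * (u m * w m) by near: m; exact: (cvgr_gt _ uw3).
  have lt1 : 0 < 1 - u m * w m by near: m; exact: (cvgr_gt _ uw1).
  have ltw : 0 < 1 - w m * w m by near: m; exact: (cvgr_gt _ w1).
  have kn : (3 * k m < m.+4.+1)%N.
    rewrite -(ltr_nat R) natrM kE nE -subr_gt0.
    rewrite (_ : _ - _ = (1 - 3 * (u m * w m)) / w m ^+ 2); last first.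
      by field; rewrite gt_eqF.
    by rewrite divr_gt0 ?exprn_gt0.
  apply/andP; split.
    have := survival_ge (@survival0 R m) (@survival_step_ge R m) kn.
    apply: le_trans.
    rewrite ler_expR lerN2 le_eqVlt; apply/orP; left; apply/eqP.
    rewrite kE nE; field; lra.
  have /le_trans := survival_le (@survival0 R m) (@survival_ge0 R m)
    (@survival_step_le R m) kn isT; apply.
  rewrite le_eqVlt; apply/orP; left; apply/eqP; congr (expR (- _) + _).
    by rewrite kE nE; field; lra.
  by rewrite kE nE; field; lra.
- apply: continuous_cvg; first exact: continuous_expR.
  apply: cvgN; rewrite -[X in _ --> X]divr1; apply: cvgM => //.
  by apply: cvgV => //; exact: oner_neq0.
- rewrite -[X in _ --> X]addr0; apply: cvgD.
    apply: continuous_cvg; first exact: continuous_expR.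
    by apply: cvgN; rewrite -[X in _ --> X]subr0; exact: cvgB.
  rewrite -[X in _ --> X](_ : 5 * (x ^+ 3 * 0) / (1 * 1) = 0); last first.
    by rewrite !mulr0 mul0r.
  apply: cvgM.
    apply: cvgM; first exact: cvg_cst.
    by apply: cvgM => //; exact: (cvg_comp _ _ ux (@exprn_continuous R 3 x)).
  by apply: cvgV; [rewrite mulr1 oner_neq0|exact: cvgM].
Unshelve. all: by end_near. Qed.

End limit.

(** * The distribution functions *)

Lemma uniform_permE (R : realType) n (A : {set 'S_n}) :
  uniform_perm R 'I_n [set` A] = (#|A|%:R / n`!%:R)%:E.
Proof.
rewrite /uniform_perm /mscale /= /counting asboolT; last exact: finite_finset.
have -> : fset_set [set` A] = [fset x | x in A]%fset.
  apply/fsetP => x; rewrite in_fset_set; last exact: finite_finset.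
  by rewrite mem_setE in_fsetE.
by rewrite card_finset -EFinM mulrC -card_Sn.
Qed.

Lemma ccdf_scaled_K (R : realType) m (x : R) : 0 <= x ->
  ccdf (scaled_K_RV R m.+4.+1) x =
  (survival R m (Num.truncn (x * Num.sqrt m.+4.+1%:R)))%:E.
Proof.
move=> x0; rewrite /ccdf /distribution /pushforward /survival -uniform_permE.
congr (uniform_perm _ _ _); apply/seteqP.
have s0 : 0 < Num.sqrt m.+4.+1%:R :> R by rewrite sqrtr_gt0.
have E (pi : 'S_m.+4.+1) : (x < scaled_K R pi) =
    (pi \in good m (m.+4.+1 - Num.truncn (x * Num.sqrt m.+4.+1%:R))%N).
  by rewrite -K_gtE /scaled_K ltr_pdivlMr // truncn_lt_nat // mulr_ge0 // ltW.
by split => pi /=; rewrite in_itv /= andbT E.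
Qed.

Lemma cdf_scaled_K_neg (R : realType) n (x : R) : x < 0 ->
  cdf (scaled_K_RV R n) x = 0%E.
Proof.
move=> x0; rewrite /cdf /distribution /pushforward.
rewrite (_ : _ @^-1` _ = set0) ?measure0 //.
apply/seteqP; split => // pi /=; rewrite in_itv /= => /le_lt_trans /(_ x0).
by rewrite ltNge divr_ge0 // sqrtr_ge0.
Qed.

Section rayleigh_law.
Context {R : realType}.

(** Truncating the argument at 0 gives one continuous formula on the whole
    line. *)
Definition rayleigh_cdf (x : R) : R := 1 - expR (- (Num.max 0 x) ^+ 2).

Lemma rayleigh_cdf_nondecreasing : nondecreasing rayleigh_cdf.
Proof.
move=> x y xy; rewrite /rayleigh_cdf lerD2l lerN2 ler_expR lerN2.
have m0 z : 0 <= Num.max 0 z :> R by rewrite le_max lexx.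
by rewrite ler_pXn2r ?nnegrE // ge_max m0 le_max xy orbT.
Qed.

Lemma rayleigh_cdf_continuous : continuous rayleigh_cdf.
Proof.
move=> x; apply: cvgB; first exact: cvg_cst.
apply: continuous_cvg; first exact: continuous_expR.
apply: cvgN.
have maxc : {for x, continuous (Num.max (0 : R))}.
  apply: continuous_max; [exact: cst_continuous | exact: id].
exact: (cvg_comp _ _ maxc (@exprn_continuous R 2 _)).
Qed.

HB.instance Definition _ := isCumulative.Build R _ R rayleigh_cdf
  rayleigh_cdf_nondecreasing (right_continuousW rayleigh_cdf_continuous).

Lemma rayleigh_cdf_cvgNy : rayleigh_cdf @ -oo --> (0 : R).
Proof.
apply: cvg_near_cst; near=> x; apply/eqP.
rewrite /rayleigh_cdf max_l ?expr0n ?oppr0 ?expR0 ?subrr //.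
Unshelve. all: by end_near. Qed.

Lemma rayleigh_cdf_cvgy : rayleigh_cdf @ +oo --> (1 : R).
Proof.
rewrite -[X in _ --> X]subr0; apply: cvgB; first exact: cvg_cst.
have sq : (Num.max 0 x) ^+ 2 @[x --> +oo] --> (+oo : set_system R).
  apply: cvg_trans (@cvgr_expr2 R); apply: near_eq_cvg; near=> x.
  by rewrite max_r.
exact: (cvg_comp _ _ sq (@cvgr_expR R)).
Unshelve. all: by end_near. Qed.

HB.instance Definition _ := isCumulativeBounded.Build R 0 1 rayleigh_cdf
  rayleigh_cdf_cvgNy rayleigh_cdf_cvgy.

Definition rayleigh_law : probability (measurableTypeR R) R :=
  lebesgue_stieltjes_measure rayleigh_cdf.

Definition rayleigh_id : measurableTypeR R -> R := idfun.

HB.instance Definition _ := isMeasurableFun.Build _ _ _ _ rayleigh_id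
  (@measurable_id _ _ setT).

Definition rayleigh_RV : {RV rayleigh_law >-> R} := rayleigh_id.

Lemma cdf_rayleigh (x : R) : cdf rayleigh_RV x = (rayleigh_cdf x)%:E.
Proof. exact: cdf_lebesgue_stieltjes_id. Qed.

End rayleigh_law.

Lemma cvg_cdf_scaled_K (R : realType) (x : R) :
  cdf (scaled_K_RV R m.+4.+1) x @[m --> \oo] --> (rayleigh_cdf x)%:E.
Proof.
rewrite /rayleigh_cdf; have [x0|x0] := leP 0 x; last first.
  rewrite expr0n oppr0 expR0 subrr.
  under eq_fun do rewrite cdf_scaled_K_neg //.
  exact: cvg_cst.
under eq_fun do rewrite cdf_1_ccdf ccdf_scaled_K // -EFinB.
apply: cvg_EFin; first exact: nearW.
by apply: cvgB; [exact: cvg_cst | exact: cvg_survival].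
Qed.

(* The sequence (K_n / sqrt n) is indexed from n = 3 on. *)
Theorem theorem4p3 (R : realType) :
  exists (d : measure_display) (T : measurableType d) (P : probability T R)
    (X : {RV P >-> R}),
    [/\ cvg_in_distribution (fun n => scaled_K_RV R n.+3) X,
        (forall x : R, 0 <= x -> ccdf X x = (expR (- x ^+ 2))%:E)
      & rayleigh (1 / Num.sqrt 2) X].
Proof.
have tail (x : R) : 0 <= x -> ccdf rayleigh_RV x = (expR (- x ^+ 2))%:E.
  move=> x0; rewrite ccdf_1_cdf cdf_rayleigh /rayleigh_cdf max_r //.
  by rewrite -EFinB opprB addrC subrK.
exists _, _, rayleigh_law, rayleigh_RV; split=> //.
(* The bounds are available from n = 5 on, hence the shift by 2. *)
- move=> x _; rewrite -(cvg_shiftn 2) cdf_rayleigh.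
  by under eq_fun do rewrite addn2; exact: cvg_cdf_scaled_K.
- move=> x x0; rewrite tail //; congr (expR _)%:E.
  by rewrite div1r exprVn sqr_sqrtr // divff ?divr1 // pnatr_eq0.
Qed.
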